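(* Let $\theta\in(0,1)$ and let $f_\theta\colon\mathbb{R}\times\mathbb{R}\to\mathbb{R}$ be $f_\theta(x,y)=x+(1-2\theta)y$. Let $\beta\in\mathbb{R}$ be a root of the quadratic equation $x^{2}-\bigl(2+(\theta^{-1}-1)^{2}\bigr)x+1=0$. Then for every $n\in\mathbb{N}$ there is a matrix $M\in\mathsf{Sym}(f_\theta;1^{(n)},\beta^{(n)})$ with $\operatorname{rank}(M)\leq n+3$.
   Context: For a function $f$ and a tuple $(a_1,\dots,a_N)$ of reals, $\mathsf{Sym}(f;a_1,\dots,a_N)$ denotes the set of all $N\times N$ real symmetric matrices with zero diagonal whose $(i,j)$th entry, for each $i<j$, is either $f(a_i,a_j)$ or $f(a_j,a_i)$. The notation $(1^{(n)},\beta^{(n)})$ denotes the $2n$-tuple consisting of $n$ copies of $1$ followed by $n$ copies of $\beta$. *)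

(* Defs.v *)
From mathcomp Require Import all_boot all_order all_algebra.
From mathcomp Require Import classical_sets reals.

Set Implicit Arguments.
Unset Strict Implicit.
Unset Printing Implicit Defensive.

Import Order.TTheory GRing.Theory Num.Theory.
Local Open Scope classical_set_scope.
Local Open Scope ring_scope.

Definition Sym (R : realType) (f : R -> R -> R) (N : nat) (a : N.-tuple R) :
    set 'M[R]_N :=
  [set M | [/\ M^T = M,
               forall i, M i i = 0 &
               forall i j : 'I_N, (i < j)%N ->
                 M i j = f (tnth a i) (tnth a j) \/
                 M i j = f (tnth a j) (tnth a i)]].

Definition ftheta (R : realType) (theta : R) (x y : R) : R :=
  x + (1 - 2 * theta) * y.

Definition two_block (R : realType) (n : nat) (a b : R) : (n + n).-tuple R :=
  [tuple of nseq n a ++ nseq n b].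

(* Main.v *)
(** Take every off-diagonal-block entry equal to [f beta 1], except on the
    diagonal of that block where it is [f 1 beta].  Then [M] is the sum of a
    matrix with constant blocks (rank at most 2) and of
    [[-a I, d I], [d I, -a beta I]] with [a = 2 (1 - theta)] and
    [d = f 1 beta - f beta 1 = 2 theta (1 - beta)].  The quadratic equation says
    [d^2 = a^2 beta], so the second summand has rank [n].  This gives the rank
    bound [n + 2]. *)
Require Import Defs.
From mathcomp Require Import all_boot all_order all_algebra.
From mathcomp Require Import classical_sets reals.
From mathcomp Require Import ring.
Import Order.TTheory GRing.Theory Num.Theory.
Local Open Scope classical_set_scope.
Local Open Scope ring_scope.

Lemma tnth_two_block_lshift (R : realType) (n : nat) (x y : R) (i : 'I_n) :
  tnth (two_block n x y) (lshift n i) = x.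
Proof. by rewrite (tnth_nth 0) nth_cat size_nseq /= ltn_ord nth_nseq ltn_ord. Qed.

Lemma tnth_two_block_rshift (R : realType) (n : nat) (x y : R) (i : 'I_n) :
  tnth (two_block n x y) (rshift n i) = y.
Proof.
by rewrite (tnth_nth 0) nth_cat size_nseq /= ltnNge leq_addr /= addKn nth_nseq ltn_ord.
Qed.

(** The lower block row is [d / a] times the upper one, since [d / a * d = b]; so the matrix factors
    through dimension [n]. *)
Lemma mxrank_scalar_block (F : fieldType) (n : nat) (a b d : F) :
  a != 0 -> d ^+ 2 = a * b ->
  (\rank (block_mx a%:M d%:M d%:M b%:M : 'M_(n + n)) <= n)%N.
Proof.
move=> a0 dab.
have -> : block_mx a%:M d%:M d%:M b%:M =
    col_mx 1%:M (d / a)%:M *m row_mx a%:M d%:M :> 'M_(n + n).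
  rewrite mul_col_row -!scalar_mxM !mul1r divfK //.
  by rewrite mulrAC -expr2 dab mulrAC mulfV // mul1r.
exact: leq_trans (mxrankM_maxl _ _) (rank_leq_col _).
Qed.

(** All rows within one half coincide, so the matrix is a two-row matrix multiplied on the left by
    the indicator columns of the two halves. *)
Lemma mxrank_const_block (F : fieldType) (m n : nat) (a b c d : F) :
  (\rank (block_mx (const_mx a) (const_mx b) (const_mx c) (const_mx d)
          : 'M_(m + m, n + n)) <= 2)%N.
Proof.
have const_mul (x : F) : const_mx x = (const_mx 1 : 'cV_m) *m const_mx x
    :> 'M_(m, n) by apply/matrixP => i j; rewrite !mxE big_ord1 !mxE mul1r.
have -> : block_mx (const_mx a) (const_mx b) (const_mx c) (const_mx d) =
    block_mx (const_mx 1) 0 0 (const_mx 1) *m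
    (block_mx (const_mx a) (const_mx b) (const_mx c) (const_mx d)
      : 'M_(1 + 1, n + n)) :> 'M_(m + m, n + n).
  by rewrite mulmx_block !mul0mx !addr0 !add0r -!const_mul.
exact: leq_trans (mxrankM_maxl _ _) (rank_leq_col _).
Qed.

Theorem theorem1p5 (R : realType) (theta : R)
    (htheta0 : 0 < theta) (htheta1 : theta < 1) (beta : R)
    (hbeta : beta ^+ 2 - (2 + (theta^-1 - 1) ^+ 2) * beta + 1 = 0) (n : nat) :
  exists2 M : 'M[R]_(n + n), Sym (ftheta theta) (two_block n 1 beta) M &
    (\rank M <= n + 3)%N.
Proof.
pose a : R := 2 * (1 - theta).
pose q := ftheta theta beta 1.
pose d : R := 2 * theta * (1 - beta).
have a0 : a != 0 by rewrite mulf_neq0 ?pnatr_eq0 // subr_eq0 eq_sym lt_eqF.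
have d2 : d ^+ 2 = - a * - (a * beta).
  have t0 : theta != 0 by rewrite gt_eqF.
  apply/eqP; rewrite -subr_eq0; apply/eqP.
  (* The difference [d ^+ 2 - a ^+ 2 * beta] is the quadratic polynomial at [beta] times
     [4 * theta ^+ 2], which clears the denominators. *)
  rewrite -[RHS](mulr0 (4 * theta ^+ 2)) -hbeta /d /a; field.
  exact: t0.
(* Since [ftheta theta x x = a * x], the constant diagonal blocks carry the required off-diagonal
   entries, and the scalar blocks cancel their diagonals. *)
exists (block_mx (- a)%:M d%:M d%:M (- (a * beta))%:M +
        block_mx (const_mx a) (const_mx q) (const_mx q) (const_mx (a * beta))).
- split.
  + by rewrite linearD /= !tr_block_mx !tr_scalar_mx !trmx_const.
  + move=> i; rewrite mxE; case: (split_ordP i) => k ->.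
      by rewrite !block_mxEul !mxE eqxx addNr.
    by rewrite !block_mxEdr !mxE eqxx addNr.
  + move=> i j; rewrite mxE.
    case: (split_ordP i) => k ->; case: (split_ordP j) => l -> ltkl.
    * rewrite !tnth_two_block_lshift !block_mxEul !mxE.
      have /negbTE -> : k != l by apply: contraTneq ltkl => ->; rewrite ltnn.
      by left; rewrite mulr0n /ftheta /a; ring.
    * rewrite tnth_two_block_lshift tnth_two_block_rshift !block_mxEur !mxE.
      (* On the diagonal of this block [d + q] is [ftheta theta 1 beta]; elsewhere [q] alone
         remains. *)
      case: (k == l); [left | right]; rewrite ?mulr1n ?mulr0n /q /d /ftheta; ring.
    (* The lower left block lies below the diagonal: its row indices are at least [n], its column
       indices less than [n]. *)
    * by move: ltkl; rewrite /= ltnNge (leq_trans (ltnW (ltn_ord l))) ?leq_addr.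
    * rewrite !tnth_two_block_rshift !block_mxEdr !mxE.
      have /negbTE -> : k != l by apply: contraTneq ltkl => ->; rewrite ltnn.
      by left; rewrite mulr0n /ftheta /a; ring.
- apply: leq_trans (mxrank_add _ _) _; apply: leq_add.
    by apply: mxrank_scalar_block; rewrite ?oppr_eq0.
  exact: leq_trans (mxrank_const_block _ _ _ _ _ _ _) _.
Qed.
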